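(* Assume: (a) for every $x\in\mathsf X$, if $a_n\to a$ in $\mathsf A$ then $p(\,\cdot\,|x,a_n)\to p(\,\cdot\,|x,a)$ setwise; (b) $\mathsf A$ is compact; (c) $c$ is a non-negative bounded measurable function on $\mathsf X\times\mathsf A$ with $c(x,\,\cdot\,)$ continuous on $\mathsf A$ for every $x\in\mathsf X$; (e) for every $\pi\in S$, the kernel $Q_\pi$ has a unique invariant probability measure $\nu_\pi$; (g) $\mathsf M:=\bigcap_{\pi\in S}\mathsf M_\pi\ne\emptyset$; and assume that at least one of the following holds: (f1) the set $\Gamma_S:=\{\nu\in\mathcal P(\mathsf X):\nu Q_\pi=\nu\text{ for some }\pi\in S\}$ is relatively sequentially compact in the setwise topology; (f2) there exists $x'\in\mathsf X$ such that for every Borel set $B\subset\mathsf X$, $\lambda_n^{\pi,x'}(B)\to\nu_\pi(B)$ as $n\to\infty$, uniformly in $\pi\in S$. Let the initial distribution $\mu$ be concentrated on some $x\in\mathsf M$ (i.e. $\mu=\delta_x$). Let $\pi\in S$ and let $\{\pi^k\}_{k\ge1}$ be the quantized approximations of $\pi$. Then $w_A(\pi^k,\mu)\to w_A(\pi,\mu)$ as $k\to\infty$.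
   Context: Markov decision process: the state space $\mathsf X$ and action space $\mathsf A$ are Polish (complete separable metric) spaces with Borel $\sigma$-algebras; every action in $\mathsf A$ is admissible in every state; $p(\,\cdot\,|x,a)$ is a stochastic kernel on $\mathsf X$ given $\mathsf X\times\mathsf A$ (transition probability). ''Measurable'' means Borel measurable. $d_{\mathsf A}$ is the metric of $\mathsf A$; $\mathcal P(\mathsf X)$ is the set of Borel probability measures on $\mathsf X$. A deterministic stationary policy $\pi$ is given (induced) by a measurable function $f:\mathsf X\to\mathsf A$: at each time $n$ the action is $a_n=f(x_n)$. $S$ denotes the set of all deterministic stationary policies. $P^\pi_\mu$ (expectation $E^\pi_\mu$) is the law of the process $(x_0,a_0,x_1,a_1,\dots)$ with $x_0\sim\mu$, actions chosen by $\pi$, and $x_{n+1}\sim p(\,\cdot\,|x_n,a_n)$ given the past. $\lambda_n^{\pi,x}$ denotes the law of $x_n$ when $x_0=x$. For a measure $\nu$ and function $g$, $\nu(g)=\int g\,d\nu$. For $\pi\in S$ induced by $f$, put $c_f(x)=c(x,f(x))$ and $Q_\pi(\,\cdot\,|x)=p(\,\cdot\,|x,f(x))$, a stochastic kernel on $\mathsf X$; $\nu Q_\pi=\int Q_\pi(\,\cdot\,|x)\,\nu(dx)$. Average cost: $w_A(\pi,\mu)=\limsup_{N\to\infty}\frac1N E^\pi_\mu\big[\sum_{n=0}^{N}c(x_n,a_n)\big]$, and $w_A(\pi,x)=w_A(\pi,\delta_x)$. For $\pi\in S$ induced by $f$ with invariant probability measure $\nu_\pi$, $\mathsf M_\pi$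 is the set of all $x\in\mathsf X$ such that $\lim_{N\to\infty}\frac1N\sum_{n=0}^{N-1}\lambda_n^{\pi,x}(c_f)=\nu_\pi(c_f)$ (so that $w_A(\pi,x)=\nu_\pi(c_f)$). Measures $\nu_n\to\nu$ setwise means $\nu_n(B)\to\nu(B)$ for every measurable $B$. A set $\Gamma\subset\mathcal P(\mathsf X)$ is relatively sequentially compact in the setwise topology if every sequence in $\Gamma$ has a subsequence converging setwise to an element of $\mathcal P(\mathsf X)$. Quantized approximations: since $\mathsf A$ is compact, fix for each $k\ge1$ a finite set $\Lambda_k=\{a_1,\dots,a_{m_k}\}\subset\mathsf A$ with $\min_{1\le i\le m_k}d_{\mathsf A}(a,a_i)<1/k$ for all $a\in\mathsf A$. If $\pi\in S$ is induced by $f$, let $q_k:\mathsf X\to\Lambda_k$, $q_k(x)=\arg\min_{a\in\Lambda_k}d_{\mathsf A}(f(x),a)$, with ties broken so that $q_k$ is measurable. The policy $\pi^k\in S$ induced by $q_k$ is called the ($k$-th) quantized approximation of $\pi$. *)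

(* Defs.v *)
From HB Require Import structures.
From mathcomp Require Import all_boot all_order all_algebra.
From mathcomp Require Import all_classical all_reals all_analysis.

Set Implicit Arguments.
Unset Strict Implicit.
Unset Printing Implicit Defensive.
Import Order.TTheory GRing.Theory Num.Theory.
Import numFieldNormedType.Exports.

Local Open Scope classical_set_scope.
Local Open Scope ring_scope.
Local Open Scope ereal_scope.

HB.mixin Record isSeparable T & Topological T := {
  separable : exists2 D : set T, countable D & dense D
}.

(* Complete separable metric spaces; they are pointed (hence nonempty), as
   measurableType and completeType require. *)
#[short(type="polishType")]
HB.structure Definition Polish (R : numDomainType) :=
  {T of Complete T & Metric R T & isSeparable T}.

(* By separability, the product sigma-algebra of [borel X * borel A] is the
   Borel sigma-algebra of the product space. *)
Notation borel T := (g_sigma_algebraType (@open T)).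

Section setwise.
Context d (T : measurableType d) (R : realType).

Definition setwise_cvg (nu_ : nat -> set T -> \bar R) (nu : set T -> \bar R) :=
  forall B, measurable B -> nu_ n B @[n --> \oo] --> nu B.

Definition setwise_rel_seq_compact (Gamma : set (probability T R)) :=
  forall nu_ : nat -> probability T R, (forall n, Gamma (nu_ n)) ->
    exists (phi : nat -> nat) (nu : probability T R),
      {homo phi : m n / (m < n)%N} /\
      setwise_cvg (fun n => nu_ (phi n)) nu.

End setwise.

Section mdp.
Context {R : realType} (X A : polishType R).

(* A deterministic stationary policy is identified with the measurable
   function inducing it. *)
Definition policy := {mfun borel X >-> borel A}.

(* Sets of trajectories determined by one state-action pair whose time is
   in I. *)
Definition coord_sets (I : set nat) : set (set (nat -> borel X * borel A)) :=
  [set E | exists2 n, I n & exists2 U, measurable U & E = [set w | U (w n)]].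

(* Sequences (x_0, a_0), (x_1, a_1), ... with the product sigma-algebra. *)
Definition traj := g_sigma_algebraType (coord_sets setT).

Definition past (n : nat) : set (set traj) :=
  <<s coord_sets [set i | (i <= n)%N] >>.

Definition state (n : nat) (w : traj) : borel X := (w n).1.

Definition action (n : nat) (w : traj) : borel A := (w n).2.

Lemma measurable_state n : measurable_fun [set: traj] (state n).
Proof.
move=> _ B mB; rewrite setTI; apply: sub_sigma_algebra.
exists n => //; exists (fst @^-1` B) => //.
by rewrite -[fst @^-1` B]setTI; exact: measurable_fst.
Qed.

HB.instance Definition _ n :=
  isMeasurableFun.Build _ _ _ _ (state n) (measurable_state n).

Variable p : R.-pker (borel X * borel A)%type ~> borel X.

(* P is the law of (x_0, a_0, x_1, a_1, ...) under f from the initial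
   distribution mu. The last clause is the conditional law of x_{n+1} given
   (x_0, a_0, ..., x_n, a_n), in integrated form. *)
Definition is_process_law (f : policy) (mu : probability (borel X) R)
    (P : probability traj R) :=
  [/\ forall B, measurable B -> P (state 0 @^-1` B) = mu B,
      forall n, {ae P, forall w, action n w = f (state n w)} &
      forall n H B, past n H -> measurable B ->
        P (H `&` state n.+1 @^-1` B) =
        \int[P]_(w in H) p (state n w, action n w) B].

Definition policy_kernel (f : policy) (x : borel X) :
  {measure set (borel X) -> \bar R} := p (x, f x).

Definition invariant (f : policy) (nu : probability (borel X) R) :=
  forall B, measurable B -> \int[nu]_x policy_kernel f x B = nu B.

Definition invariant_measures : set (probability (borel X) R) :=
  [set nu | exists f, invariant f nu].

(* Measures are total on [set X], so uniqueness has to be stated as equality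
   on measurable sets. *)
Definition unique_invariant (f : policy) (nu : probability (borel X) R) :=
  invariant f nu /\
  forall nu', invariant f nu' -> forall B, measurable B -> nu' B = nu B.

Definition state_law (P : probability traj R) (n : nat) :
  probability (borel X) R := distribution P (state n).

Variable c : X * A -> R.

Definition policy_cost (f : policy) (x : X) : R := c (x, f x).

(* The term N = 0, where 0^-1 = 0, does not affect the limsup. *)
Definition average_cost (P : probability traj R) : \bar R :=
  limn_esup (fun N : nat =>
    (N%:R^-1)%:E * 'E_P[fun w => (\sum_(0 <= n < N.+1) c (w n))%R]).

(* P f mu is meant to be the process law under f with initial distribution mu,
   and nu f the invariant probability measure of f. *)
Definition ergodic_points (P : policy -> probability (borel X) R ->
    probability traj R) (nu : policy -> probability (borel X) R)
    (f : policy) : set X :=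
  [set x | (N%:R^-1)%:E * (\sum_(0 <= n < N)
             \int[state_law (P f (\d_(x : borel X))) n]_y (policy_cost f y)%:E)
           @[N --> \oo] --> \int[nu f]_y (policy_cost f y)%:E].

End mdp.

Section quantization.
Context {R : realType} (X A : polishType R).

(* Only the indices k >= 1 are constrained. *)
Definition quantization_nets (Lambda : nat -> set A) :=
  forall k, (0 < k)%N -> finite_set (Lambda k) /\
    forall a, exists2 b, Lambda k b & (mdist a b < k%:R^-1)%R.

Definition quantized_approximation (Lambda : nat -> set A) (f : policy X A)
    (q : nat -> policy X A) :=
  forall k, (0 < k)%N -> forall x, Lambda k (q k x) /\
    forall b, Lambda k b -> (mdist (f x : A) (q k x : A) <= mdist (f x : A) b)%R.

End quantization.

(* Main.v *)
Require Import Defs.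
From HB Require Import structures.
From mathcomp Require Import all_boot all_order all_algebra.
From mathcomp Require Import all_classical all_reals all_analysis.
From mathcomp Require Import measurable_realfun ring lra.

Set Implicit Arguments.
Unset Strict Implicit.
Unset Printing Implicit Defensive.
Import Order.TTheory GRing.Theory Num.Theory.
Import numFieldNormedType.Exports HBNNSimple.

Local Open Scope classical_set_scope.
Local Open Scope ring_scope.
Local Open Scope ereal_scope.

(** The average cost of a stationary policy [g], started at a point of
    [ergodic_points c P nu g], is the integral of [c_g : y |-> c (y, g y)]
    against the invariant measure [nu g] (lemma [average_cost_limit]). So it
    is enough to show that the integral of [c_(q k)] against [nu (q k)] tends
    to the integral of [c_f] against [nu f]. Here both the integrand and the
    measure vary with [k].

    The tool for this is a dominated convergence theorem with varying measures
    ([setwise_dominated_cvg]): if [mu_ n] tends to [mu] setwise, and [g_ n] is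
    uniformly bounded and tends to [h] pointwise, then the integral of [g_ n]
    against [mu_ n] tends to the integral of [h] against [mu]. Pointwise
    convergence makes the sets [E N], on which some [g_ m] with [N <= m] is far
    from [h], decrease to the empty set. Hence [mu (E N)] is small for some
    [N], and setwise convergence at this one set makes [mu_ n (E N)] small for
    all large [n]; off [E N] all [g_ m] with [N <= m] are uniformly close to [h].

    The quantized actions [q k x] tend to [f x]
    ([quantized_approximation_cvg]), so [c_(q k)] tends to [c_f] pointwise
    because [c (x, _)] is continuous. What remains is the setwise convergence
    of [nu (q k)] to [nu f], where the two alternative assumptions separate:
    - under compactness ([invariant_cvg_of_compact]), every subsequence of
      [nu (q k)] has a setwise convergent further subsequence. By the theorem
      above, applied to the kernels, the limit is invariant for [f], so it is
      [nu f] by uniqueness;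
    - under uniform convergence of the state laws
      ([invariant_cvg_of_uniform]), [nu g] is close to the law of the state at
      a fixed time [n], uniformly in the policy [g], and the law of the state
      at time [n] under [q k] tends setwise to that under [f], by induction on
      [n] and the same theorem. *)

(** * Convergence of sequences *)

(** If [u] leaves a neighbourhood of [l] infinitely often, the indices where it
    does form a [psi] along which no subsequence can converge to [l]. The
    bounds [n <= psi n] and [n <= phi n] say that the extractions tend to
    infinity, and compose. *)
Lemma cvg_subsequences (T : topologicalType) (u : nat -> T) (l : T) :
  (forall psi : nat -> nat, (forall n, n <= psi n)%N ->
    exists phi : nat -> nat, (forall n, n <= phi n)%N /\
      u (psi (phi n)) @[n --> \oo] --> l) ->
  u n @[n --> \oo] --> l.
Proof.
move=> sub U lU; rewrite nbhs_filterE; apply: contrapT => uU.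
have /choice[psi psiP] : forall N, exists n, (N <= n)%N /\ ~ U (u n).
  move=> N; apply: contrapT => NU; apply: uU; exists N => // n /= Nn.
  by apply: contrapT => nU; apply: NU; exists n.
have [phi [_ /(_ _ lU)[N _ /(_ N (leqnn N))]]] :=
  sub psi (fun n => (psiP n).1).
exact: (psiP (phi N)).2.
Qed.

Lemma cvg_extraction (T : topologicalType) (u : nat -> T) (l : T)
    (phi : nat -> nat) : (forall n, n <= phi n)%N ->
  u n @[n --> \oo] --> l -> u (phi n) @[n --> \oo] --> l.
Proof.
move=> phin ul U /ul[N _ NU]; exists N => // n /= Nn.
by apply: NU => /=; exact: leq_trans (phin n).
Qed.

Section ereal_cvg.
Context {R : realType} (u : nat -> \bar R) (l : \bar R).
Hypothesis lfin : l \is a fin_num.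

(** Two one-sided bounds without subtraction replace the distance to [l], so
    that integrals of nonnegative functions can be compared by monotonicity
    and additivity in the extended reals. *)
Lemma cvge_dist_leP : u n @[n --> \oo] --> l <->
  forall e : R, (0 < e)%R ->
    \forall n \near \oo, u n <= l + e%:E /\ l <= u n + e%:E.
Proof.
move: lfin; case: l => // r _; split.
  move=> /fine_cvgP[ufin /cvgrPdist_le ur] e e0.
  near=> n; have un : u n \is a fin_num by near: n.
  have : (`|r - fine (u n)| <= e)%R by near: n; exact: ur.
  rewrite -(fineK un) -!EFinD !lee_fin ler_distl => /andP[? ?].
  by split; lra.
move=> ur.
have ufin e n : u n <= r%:E + e%:E -> r%:E <= u n + e%:E -> u n \is a fin_num.
  by case: (u n).
apply/fine_cvgP; split.
  by apply: filterS (ur 1%R ltr01) => n [/ufin]; exact.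
apply/cvgrPdist_le => e e0; apply: filterS (ur e e0) => n [u1 u2] /=.
have unfin := ufin _ _ u1 u2.
move: u1 u2; rewrite -(fineK unfin) -!EFinD !lee_fin ler_distl.
by move=> ? ?; apply/andP; split; lra.
Unshelve. all: by end_near. Qed.

End ereal_cvg.

(** * Integrals under setwise convergence of probabilities *)

Section setwise_integrals.
Context d (T : measurableType d) (R : realType).
Implicit Types (mu : probability T R) (g h : T -> R).

Lemma integral_le_bound mu h (K : R) : measurable_fun setT h ->
  (forall x, 0 <= h x)%R -> (forall x, h x <= K)%R ->
  \int[mu]_x (h x)%:E <= K%:E.
Proof.
move=> mh h0 hK.
rewrite -[leRHS]mule1 -(@probability_setT _ _ _ mu) -integral_cst//.
apply: ge0_le_integral => //.
- by move=> x _; rewrite lee_fin.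
- exact/measurable_EFinP.
- by move=> x _; rewrite lee_fin.
Qed.

Lemma integral_bounded_fin_num mu h (K : R) : measurable_fun setT h ->
  (forall x, 0 <= h x)%R -> (forall x, h x <= K)%R ->
  \int[mu]_x (h x)%:E \is a fin_num.
Proof.
move=> mh h0 hK; apply/fin_real/andP; split.
  by apply: lt_le_trans (integral_ge0 _ _) => // x _; rewrite lee_fin.
exact: le_lt_trans (integral_le_bound mu mh h0 hK) (ltry K).
Qed.

(** Pointwise, [g <= h + e + K * \1_E]: off [E] by hypothesis, and on [E]
    because the last term alone bounds [g]. *)
Lemma le_integral_off mu g h (K e : R) (E : set T) :
  measurable_fun setT g -> measurable_fun setT h -> measurable E ->
  (forall x, 0 <= g x)%R -> (forall x, g x <= K)%R -> (forall x, 0 <= h x)%R ->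
  (0 <= e)%R -> (forall x, ~ E x -> g x <= h x + e)%R ->
  \int[mu]_x (g x)%:E <= \int[mu]_x (h x)%:E + (e%:E + K%:E * mu E).
Proof.
move=> mg mh mE g0 gK h0 e0 gh.
have K0 : (0 <= K)%R by apply: le_trans (g0 point) (gK point).
have -> : \int[mu]_x (h x)%:E + (e%:E + K%:E * mu E) =
    \int[mu]_x ((h x)%:E + (e%:E + K%:E * (\1_E x)%:E)).
  have mE1 : measurable_fun setT (fun x => (\1_E x)%:E : \bar R).
    by apply/measurable_EFinP.
  have mK : measurable_fun setT (fun x => K%:E * (\1_E x)%:E : \bar R).
    by apply: emeasurable_funM.
  have mh' : measurable_fun setT (fun x => (h x)%:E : \bar R).
    exact/measurable_EFinP.
  have h0' x : setT x -> 0 <= (h x)%:E by rewrite lee_fin.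
  have K1_ge0 x : setT x -> 0 <= K%:E * (\1_E x)%:E.
    by rewrite mule_ge0 ?lee_fin.
  have eK1_ge0 x : setT x -> 0 <= e%:E + K%:E * (\1_E x)%:E.
    by move=> Tx; rewrite adde_ge0 ?lee_fin//; exact: K1_ge0.
  have cst_ge0 x : [set: T] x -> 0 <= e%:E by rewrite lee_fin.
  have mcst : measurable_fun [set: T] (fun=> e%:E : \bar R) by [].
  rewrite (ge0_integralD _ measurableT h0' mh' eK1_ge0
    (emeasurable_funD mcst mK)).
  rewrite (ge0_integralD _ measurableT cst_ge0 mcst K1_ge0 mK).
  rewrite integral_cst// [X in e%:E * X]probability_setT mule1.
  rewrite ge0_integralZl_EFin//.
  by rewrite integral_indic// setIT.
apply: ge0_le_integral => //.
- by move=> x _; rewrite lee_fin.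
- exact/measurable_EFinP.
- apply: emeasurable_funD; first exact/measurable_EFinP.
  apply: emeasurable_funD => //; apply: emeasurable_funM => //.
  exact/measurable_EFinP.
- move=> x _; rewrite -EFinM -!EFinD lee_fin indicE.
  have [xE|/negP] := boolP (x \in E).
    by rewrite mulr1 (le_trans (gK x))// addrA lerDr addr_ge0.
  by rewrite inE mulr0 addr0 => /gh.
Qed.

Section almost_uniform.
Variables (mu_ : nat -> probability T R) (mu : probability T R).
Hypothesis mu_cvg : setwise_cvg mu_ mu.
Variables (g_ : nat -> T -> R) (h : T -> R) (K : R).
Hypotheses (mg : forall n, measurable_fun setT (g_ n))
  (g_ge0 : forall n x, (0 <= g_ n x)%R) (g_leK : forall n x, (g_ n x <= K)%R)
  (mh : measurable_fun setT h)
  (g_cvg : forall x, g_ n x @[n --> \oo] --> h x).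

Let h_ge0 x : (0 <= h x)%R.
Proof. by apply: (cvgr_to_ge (@g_cvg x)); near=> n; exact: g_ge0.
Unshelve. all: by end_near. Qed.

Let h_leK x : (h x <= K)%R.
Proof. by apply: (cvgr_to_le (@g_cvg x)); near=> n; exact: g_leK.
Unshelve. all: by end_near. Qed.

(** Egorov's argument. The threshold [N] works for the index of the function
    and the index of the measure independently; with a constant sequence of
    measures it also covers a fixed measure. *)
Lemma setwise_almost_uniform (e : R) : (0 < e)%R ->
  exists N, forall m n, (N <= m)%N -> (N <= n)%N ->
    \int[mu_ n]_x (g_ m x)%:E <= \int[mu_ n]_x (h x)%:E + e%:E /\
    \int[mu_ n]_x (h x)%:E <= \int[mu_ n]_x (g_ m x)%:E + e%:E.
Proof.
move=> e0.
have K0 : (0 <= K)%R by apply: le_trans (g_ge0 0 point) (g_leK 0 point).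
pose D m := [set x | e / 2 < `|g_ m x - h x|]%R.
pose E N := \bigcup_(m in [set m | (N <= m)%N]) D m.
have mD m : measurable (D m).
  have mf : measurable_fun setT (fun x => `|g_ m x - h x|%R).
    by apply: measurableT_comp => //; exact: measurable_funB.
  have := mf measurableT `](e / 2)%R, +oo[%classic (measurable_itv _).
  rewrite setTI; congr measurable.
  by apply/seteqP; split => x /=; rewrite in_itv/= andbT.
have mE N : measurable (E N) by exact: bigcup_measurable.
have E0 : \bigcap_N E N = set0.
  apply/seteqP; split => // x Ex.
  have /cvgrPdist_le/(_ (e / 2)%R)[|N _ NE] := @g_cvg x.
    by rewrite divr_gt0.
  have [m /= Nm Dm] := Ex N I.
  by have := NE m Nm; rewrite distrC leNgt Dm.
have muE : mu (E N) @[N --> \oo] --> 0.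
  rewrite -(measure0 mu) -E0; apply: nonincreasing_cvg_mu => //.
  - by rewrite (le_lt_trans (probability_le1 _ _))// ltry.
  - by rewrite E0.
  - move=> m n mn; apply/subsetPset => x [i /= ni Di]; exists i => //=.
    exact: leq_trans ni.
(* With [mu (E M) <= delta] and [mu_ n (E M) <= 2 * delta], this value gives
   [K * mu_ n (E M) <= e / 2]; the [+ 1] covers [K = 0]. *)
pose delta := (e / (4 * (K + 1)))%R.
have d0 : (0 < delta)%R by rewrite divr_gt0// mulr_gt0// ltr_wpDl.
have [M _ /(_ M (leqnn M))[/= + _]] :=
  (cvge_dist_leP (fun N => mu (E N)) (l := 0) isT).1 muE _ d0.
rewrite add0e => muM.
have muMf : mu (E M) \is a fin_num by exact: fin_num_measure.
have [M' _ muM'] := (cvge_dist_leP (fun n => mu_ n (E M)) muMf).1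
  (mu_cvg (mE M)) _ d0.
exists (maxn M M') => m n; rewrite !geq_max => /andP[Mm _] /andP[_ M'n].
have small : (e / 2)%:E + K%:E * mu_ n (E M) <= e%:E.
  have /= [+ _] := muM' n M'n.
  have munf : mu_ n (E M) \is a fin_num by exact: fin_num_measure.
  move: muM; rewrite -(fineK muMf) -(fineK munf) lee_fin => a1.
  rewrite -!EFinD lee_fin => a2; rewrite lee_fin.
  have : (fine (mu_ n (E M)) <= 2 * delta)%R by lra.
  move/(ler_wpM2l K0) => a3.
  have : (K * (2 * delta) <= e / 2)%R.
    rewrite /delta (_ : K * _ = (e / 2) * (K / (K + 1)))%R; last first.
      by field; rewrite gt_eqF// ltr_wpDl.
    apply: ler_piMr; first by rewrite ltW// divr_gt0.
    by rewrite ler_pdivrMr ?ltr_wpDl// mul1r lerDl.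
  lra.
have off x : ~ E M x -> (`|g_ m x - h x| <= e / 2)%R.
  by move=> Ex; rewrite leNgt; apply/negP => Dx; apply: Ex; exists m.
have e2_ge0 : (0 <= e / 2)%R by rewrite ltW// divr_gt0.
split; (apply: le_trans; last by apply: leeD2l; exact: small).
- apply: le_integral_off => // x /off; rewrite ler_distl => /andP[? ?]; lra.
- apply: le_integral_off => // x /off; rewrite ler_distl => /andP[? ?]; lra.
Unshelve. all: by end_near. Qed.

End almost_uniform.

(** The integral of a simple function is a finite combination of measures of
    sets, so it converges by definition of setwise convergence. Approximating
    [h] by one simple function, close to it in the sense of
    [setwise_almost_uniform] for [mu] and for all [mu_ n] with [n] large, gives
    the general case. *)
Lemma setwise_cvg_integral (mu_ : nat -> probability T R) mu h (K : R) :
  setwise_cvg mu_ mu -> measurable_fun setT h ->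
  (forall x, 0 <= h x)%R -> (forall x, h x <= K)%R ->
  \int[mu_ n]_x (h x)%:E @[n --> \oo] --> \int[mu]_x (h x)%:E.
Proof.
move=> mu_cvg mh h0 hK.
have mh' : measurable_fun setT (EFin \o h) by exact/measurable_EFinP.
pose s_ := nnsfun_approx measurableT mh'.
have s_cvg x : s_ n x @[n --> \oo] --> h x.
  apply: (@fine_cvg _ _ _ _ (fun n => (s_ n x)%:E) (h x)).
  by apply: cvg_nnsfun_approx => // y _; rewrite lee_fin.
have s0 n x : (0 <= s_ n x)%R by [].
have sK n x : (s_ n x <= K)%R.
  apply: le_trans (hK x); rewrite -lee_fin nnsfun_approxE.
  by apply: (@le_approx _ _ _ setT (EFin \o h)) => // y _; rewrite lee_fin.
have s_int m : \int[mu_ n]_x (s_ m x)%:E @[n --> \oo] -->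
    \int[mu]_x (s_ m x)%:E.
  rewrite (eq_cvg _ _ (fun n => integralT_nnsfun (mu_ n) (s_ m))).
  rewrite integralT_nnsfun.
  rewrite (eq_cvg _ _ (fun n => sintegralE (mu_ n) (s_ m))) sintegralE.
  rewrite fsbig_finite//=.
  under eq_cvg do rewrite fsbig_finite//=.
  apply: cvg_nnesum => r _.
    by near=> n; exact: nnsfun_mulemu_ge0.
  by apply: cvgeZl => //; apply: mu_cvg.
apply/cvge_dist_leP; first exact: integral_bounded_fin_num hK.
move=> e e0; have e3 : (0 < e / 3)%R by rewrite divr_gt0.
have ms n : measurable_fun setT (s_ n) by [].
have [N1 hN1] := setwise_almost_uniform mu_cvg ms s0 sK mh s_cvg e3.
have mu_cst : setwise_cvg (fun=> mu) mu by move=> B _; exact: cvg_cst.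
have [N2 hN2] := setwise_almost_uniform mu_cst ms s0 sK mh s_cvg e3.
pose m := maxn N1 N2.
have [h1 h2] := hN2 m m (leq_maxr _ _) (leq_maxr _ _).
have sfin := integral_bounded_fin_num mu (ms m) (s0 m) (sK m).
have [N3 _ hN3] := (cvge_dist_leP _ sfin).1 (s_int m) _ e3.
exists (maxn N1 N3) => // n /=; rewrite geq_max => /andP[N1n N3n].
have [h3 h4] := hN1 m n (leq_maxl _ _) N1n.
have [h5 h6] := hN3 n N3n.
have -> : e%:E = (e / 3)%:E + (e / 3)%:E + (e / 3)%:E.
  by rewrite -!EFinD; congr EFin; field.
rewrite !addeA; split.
  by apply: (le_trans h4); rewrite leeD2r// (le_trans h5)// leeD2r.
by apply: (le_trans h2); rewrite leeD2r// (le_trans h6)// leeD2r.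
Unshelve. all: by end_near. Qed.

(** [g_ n] is replaced by [h] under the moving measure [mu_ n], then [mu_ n] by
    [mu] for the fixed integrand [h]. *)
Lemma setwise_dominated_cvg (mu_ : nat -> probability T R) mu
    (g_ : nat -> T -> R) h (K : R) :
  setwise_cvg mu_ mu -> (forall n, measurable_fun setT (g_ n)) ->
  (forall n x, 0 <= g_ n x)%R -> (forall n x, g_ n x <= K)%R ->
  measurable_fun setT h -> (forall x, g_ n x @[n --> \oo] --> h x) ->
  \int[mu_ n]_x (g_ n x)%:E @[n --> \oo] --> \int[mu]_x (h x)%:E.
Proof.
move=> mu_cvg mg g0 gK mh g_cvg.
have h0 x : (0 <= h x)%R.
  by apply: (cvgr_to_ge (g_cvg x)); near=> n; exact: g0.
have hK x : (h x <= K)%R.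
  by apply: (cvgr_to_le (g_cvg x)); near=> n; exact: gK.
have hfin := integral_bounded_fin_num mu mh h0 hK.
apply/cvge_dist_leP => // e e0; have e2 : (0 < e / 2)%R by rewrite divr_gt0.
have [N1 hN1] := setwise_almost_uniform mu_cvg mg g0 gK mh g_cvg e2.
have [N2 _ hN2] := (cvge_dist_leP _ hfin).1
  (setwise_cvg_integral mu_cvg mh h0 hK) _ e2.
exists (maxn N1 N2) => // n /=; rewrite geq_max => /andP[N1n N2n].
have [h3 h4] := hN1 n n N1n N1n.
have [h5 h6] := hN2 n N2n.
have -> : e%:E = (e / 2)%:E + (e / 2)%:E.
  by rewrite -!EFinD; congr EFin; field.
rewrite !addeA; split.
  by apply: (le_trans h3); rewrite leeD2r.
by apply: (le_trans h6); rewrite leeD2r.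
Unshelve. all: by end_near. Qed.

End setwise_integrals.

(** * State laws and average cost of a policy *)

Section process_law.
Context {R : realType} (X A : polishType R).
Variable p : R.-pker (borel X * borel A)%type ~> borel X.

Lemma measurable_coord n :
  measurable_fun [set: traj X A] (fun w : traj X A => w n).
Proof.
move=> _ B mB; rewrite setTI; apply: sub_sigma_algebra.
by exists n => //; exists B.
Qed.

Lemma measurable_graph (f : policy X A) d (T : measurableType d)
    (k : borel X * borel A -> T) :
  measurable_fun setT k -> measurable_fun setT (fun x : borel X => k (x, f x)).
Proof.
move=> mk; apply: (measurableT_comp mk).
by apply/measurable_fun_pair => //; exact: measurable_funPT.
Qed.

Section one_law.
Variables (f : policy X A) (mu : probability (borel X) R).
Variable P : probability (traj X A) R.
Hypothesis hP : is_process_law p f mu P.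

(** Almost surely the action at time [n] is [f] of the state, so the pair of
    both depends on the state only. *)
Lemma integral_coord (k : borel X * borel A -> \bar R) n :
  measurable_fun setT k -> (forall z, 0 <= k z) ->
  \int[P]_w k (w n) = \int[state_law P n]_y k (y, f y).
Proof.
move=> mk k0; have [_ /(_ n) Pf _] := hP.
rewrite ge0_integral_distribution//; last exact: measurable_graph.
apply: ge0_ae_eq_integral => //; rewrite /comp.
- exact: measurableT_comp mk (measurable_coord n).
- exact: measurableT_comp (measurable_graph f mk) (measurable_state n).
- by move=> w _; exact: k0.
- move: Pf; apply: filterS => w /= fw _.
  by rewrite (surjective_pairing (w n)); congr (k (_, _)).
Qed.

Lemma state_law0 B : measurable B -> state_law P 0 B = mu B.
Proof. by move=> mB; have [+ _ _] := hP; exact. Qed.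

(** The transition property for the trivial past event, the set of all
    trajectories: the state laws evolve by the kernel of [f]. *)
Lemma state_lawS n B : measurable B ->
  state_law P n.+1 B = \int[state_law P n]_y policy_kernel p f y B.
Proof.
move=> mB; have [_ _ Pn] := hP.
have <- : \int[P]_w p (w n) B = \int[state_law P n]_y policy_kernel p f y B.
  exact: integral_coord (measurable_kernel p B mB) _.
transitivity (P (setT `&` state n.+1 @^-1` B)); first by rewrite setTI.
rewrite Pn//; last first.
  rewrite -setC0.
  by apply: sigma_algebraC; exact: sigma_algebra0.
by apply: eq_integral => w _; rewrite -surjective_pairing.
Qed.

(** The average cost sums [N.+1] terms against [N] in the ergodic average; the
    last term is at most [K], so it vanishes after division by [N]. *)
Lemma average_cost_limit (c : X * A -> R) (K : R) (l : \bar R) :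
  measurable_fun [set: borel X * borel A] c ->
  (forall z, 0 <= c z)%R -> (forall z, c z <= K)%R ->
  (N%:R^-1)%:E * (\sum_(0 <= n < N)
    \int[state_law P n]_y (policy_cost c f y)%:E) @[N --> \oo] --> l ->
  average_cost c P = l.
Proof.
move=> mc c0 cK cl; rewrite /average_cost.
have mcE : measurable_fun [set: borel X * borel A] (EFin \o c).
  exact/measurable_EFinP.
have mcn n : measurable_fun [set: traj X A] (fun w => (c (w n))%:E : \bar R).
  exact: measurableT_comp mcE (measurable_coord n).
set a := fun n => \int[state_law P n]_y (policy_cost c f y)%:E.
have mpc : measurable_fun [set: borel X] (policy_cost c f).
  exact: measurable_graph mc.
have pc0 y : (0 <= policy_cost c f y)%R by exact: c0.
have pcK y : (policy_cost c f y <= K)%R by exact: cK.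
have a0 n : 0 <= a n by apply: integral_ge0 => y _; rewrite lee_fin.
have afin n : a n \is a fin_num.
  exact: integral_bounded_fin_num mpc pc0 pcK.
have aK n : a n <= K%:E by exact: integral_le_bound mpc pc0 pcK.
have ec N : 'E_P[fun w => (\sum_(0 <= n < N.+1) c (w n))%R] =
    \sum_(0 <= n < N) a n + a N.
  rewrite unlock; under eq_integral do rewrite -sumEFin.
  rewrite ge0_integral_sum//; last by move=> n w _; rewrite lee_fin.
  rewrite big_nat_recr//=; congr (_ + _).
    by apply: eq_bigr => n _; rewrite (integral_coord n mcE).
  by rewrite (integral_coord N mcE).
suff : (N%:R^-1)%:E * (\sum_(0 <= n < N) a n + a N) @[N --> \oo] --> l.
  under eq_cvg do rewrite -ec.
  by move/cvg_limn_einf_sup => [].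
have invK : (N%:R^-1)%:E * K%:E @[N --> \oo] --> 0.
  rewrite -(mul0e K%:E); apply: cvgeZr => //.
  by rewrite -cvg_shiftS; exact: cvge_harmonic.
have invN0 N : 0 <= ((N%:R : R)^-1)%:E by rewrite lee_fin.
have inva : (N%:R^-1)%:E * a N @[N --> \oo] --> 0.
  apply: (squeeze_cvge _ (cvg_cst 0) invK).
  by near=> N; rewrite mule_ge0//= lee_wpmul2l.
rewrite -[l]adde0.
under eq_cvg do rewrite ge0_muleDr ?sume_ge0//.
by apply: cvgeD => //; exact: fin_num_adde_defl.
Unshelve. all: by end_near. Qed.

End one_law.

Lemma policy_kernel_fin_num (f : policy X A) y B : measurable B ->
  policy_kernel p f y B \is a fin_num.
Proof.
move=> mB; rewrite ge0_fin_numE//.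
apply: le_lt_trans (ltry 1).
by rewrite -(@prob_kernel _ _ _ _ _ p (y, f y)) le_measure// inE.
Qed.

(** * Pointwise convergent policies *)

Section convergent_policies.
Variables (f_ : nat -> policy X A) (f : policy X A).
Hypothesis f_cvg : forall x : X, (f_ n x : A) @[n --> \oo] --> (f x : A).

Section one_step.
Hypothesis p_cvg : forall (x : X) (a_ : nat -> A) (a : A),
  a_ n @[n --> \oo] --> a -> setwise_cvg (fun n => p (x, a_ n)) (p (x, a)).

Lemma integral_policy_kernel_cvg (mu_ : nat -> probability (borel X) R)
    (mu : probability (borel X) R) : setwise_cvg mu_ mu ->
  forall B, measurable B -> \int[mu_ n]_y policy_kernel p (f_ n) y B
    @[n --> \oo] --> \int[mu]_y policy_kernel p f y B.
Proof.
move=> mu_cvg B mB.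
have fineE g (m : probability (borel X) R) :
    \int[m]_y policy_kernel p g y B =
    \int[m]_y (fine (policy_kernel p g y B))%:E.
  by apply: eq_integral => y _; rewrite fineK// policy_kernel_fin_num.
under eq_cvg do rewrite fineE; rewrite fineE.
have mk g : measurable_fun setT (fun y => fine (policy_kernel p g y B)).
  apply: measurableT_comp => //.
  exact: measurable_graph (measurable_kernel p B mB).
apply: (@setwise_dominated_cvg _ _ _ _ _
  (fun n y => fine (policy_kernel p (f_ n) y B)) _ 1%R) => //.
- move=> n y; rewrite -lee_fin fineK ?policy_kernel_fin_num//.
  by rewrite -(@prob_kernel _ _ _ _ _ p (y, f_ n y)) le_measure// inE.
- move=> y; apply: fine_cvg; rewrite fineK ?policy_kernel_fin_num//.
  exact: (p_cvg (@f_cvg y)).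
Qed.

(** Induction on the time [n]: one step integrates the converging kernels
    against the laws at time [n], which converge setwise. *)
Lemma state_law_setwise_cvg (mu : probability (borel X) R)
    (P_ : nat -> probability (traj X A) R) (P : probability (traj X A) R) n :
  (forall k, is_process_law p (f_ k) mu (P_ k)) -> is_process_law p f mu P ->
  setwise_cvg (fun k => state_law (P_ k) n) (state_law P n).
Proof.
move=> hP_ hP; elim: n => [|n IHn] B mB.
  rewrite (state_law0 hP mB).
  by under eq_cvg do rewrite (state_law0 (hP_ _) mB); exact: cvg_cst.
rewrite (state_lawS hP _ mB).
under eq_cvg do rewrite (state_lawS (hP_ _) _ mB).
exact: integral_policy_kernel_cvg.
Qed.

(** The equation [nu_ n Q_n = nu_ n] passes to the limit on every measurable
    set, because the kernels [Q_n] converge along with the measures. *)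
Lemma invariant_setwise_limit (nu_ : nat -> probability (borel X) R)
    (nu : probability (borel X) R) :
  (forall n, Defs.invariant p (f_ n) (nu_ n)) -> setwise_cvg nu_ nu ->
  Defs.invariant p f nu.
Proof.
move=> nu_inv nu_cvg B mB.
have h := integral_policy_kernel_cvg nu_cvg mB.
have /= := cvg_unique _ h; apply => //.
by under eq_cvg do rewrite nu_inv//; exact: nu_cvg.
Qed.

End one_step.

Lemma integral_policy_cost_cvg (c : X * A -> R) (K : R)
    (mu_ : nat -> probability (borel X) R) (mu : probability (borel X) R) :
  measurable_fun [set: borel X * borel A] c ->
  (forall z, 0 <= c z)%R -> (forall z, c z <= K)%R ->
  (forall x : X, continuous (fun a : A => c (x, a))) ->
  setwise_cvg mu_ mu ->
  \int[mu_ n]_y (policy_cost c (f_ n) y)%:E @[n --> \oo] -->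
  \int[mu]_y (policy_cost c f y)%:E.
Proof.
move=> mc c0 cK cc mu_cvg.
have mpc g : measurable_fun [set: borel X] (policy_cost c g).
  exact: (measurable_graph g mc).
apply: (@setwise_dominated_cvg _ (borel X) R mu_ mu
  (fun n => policy_cost c (f_ n)) (policy_cost c f) K).
- exact: mu_cvg.
- by move=> n; exact: mpc.
- by move=> n y; exact: c0.
- by move=> n y; exact: cK.
- exact: mpc.
- by move=> y; exact: (cvg_comp (fun n => f_ n y : A) (fun a : A => c (y, a))
    (@f_cvg y) (cc y (f y))).
Qed.

End convergent_policies.

(** * Convergence of the invariant measures *)

Section invariant_measures_cvg.
Variables (f_ : nat -> policy X A) (f : policy X A).
Hypothesis f_cvg : forall x : X, (f_ n x : A) @[n --> \oo] --> (f x : A).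
Hypothesis p_cvg : forall (x : X) (a_ : nat -> A) (a : A),
  a_ n @[n --> \oo] --> a -> setwise_cvg (fun n => p (x, a_ n)) (p (x, a)).
Variable nu : policy X A -> probability (borel X) R.

(** Compactness provides limit points, every one of which is invariant for [f],
    and uniqueness identifies them all with [nu f]. *)
Lemma invariant_cvg_of_compact : (forall g, unique_invariant p g (nu g)) ->
  setwise_rel_seq_compact (invariant_measures p) ->
  setwise_cvg (fun k => nu (f_ k)) (nu f).
Proof.
move=> nu_inv cpt B mB; apply: cvg_subsequences => psi psi_ge.
have [n|phi [nu' [phi_homo nu'_cvg]]] := cpt (fun n => nu (f_ (psi n))).
  by exists (f_ (psi n)); exact: (nu_inv _).1.
have phi_ge n : (n <= phi n)%N.
  by elim: n => // n IHn; exact: leq_ltn_trans IHn (phi_homo _ _ (ltnSn n)).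
exists phi; split => //.
have f_sub (x : X) : (f_ (psi (phi n)) x : A) @[n --> \oo] --> (f x : A).
  apply: (@cvg_extraction _ (fun n => f_ n x : A) _ (psi \o phi)) => [n|].
    exact: leq_trans (phi_ge n) (psi_ge _).
  exact: f_cvg.
have nu'_inv : Defs.invariant p f nu'.
  apply: (invariant_setwise_limit f_sub p_cvg _ nu'_cvg) => n.
  exact: (nu_inv _).1.
by rewrite -((nu_inv f).2 _ nu'_inv B mB); exact: nu'_cvg.
Qed.

(** Three steps of [e / 3]: from [nu (f_ k)] to the state law of [f_ k] at a
    time [n] that does not depend on [k], from there to the state law of [f] at
    time [n], and from there to [nu f]. *)
Lemma invariant_cvg_of_uniform
    (P : policy X A -> probability (traj X A) R)
    (mu : probability (borel X) R) :
  (forall g, is_process_law p g mu (P g)) ->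
  (forall B, measurable B -> forall e : R, (0 < e)%R ->
    \forall n \near \oo, forall g,
      `|state_law (P g) n B - nu g B| < e%:E) ->
  setwise_cvg (fun k => nu (f_ k)) (nu f).
Proof.
move=> hP unif B mB.
have nufin g : nu g B \is a fin_num by exact: fin_num_measure.
have lfin g n : state_law (P g) n B \is a fin_num by exact: fin_num_measure.
apply/cvge_dist_leP => // e e0; have e3 : (0 < e / 3)%R by rewrite divr_gt0.
have [n _ /(_ n (leqnn n)) close] := unif B mB _ e3.
have := (cvge_dist_leP _ (lfin f n)).1
  (state_law_setwise_cvg f_cvg p_cvg (n := n)
    (fun k => hP (f_ k)) (hP f) mB) _ e3.
apply: filterS => k.
move: (close f) (close (f_ k)).
rewrite -(fineK (nufin f)) -(fineK (nufin (f_ k))).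
rewrite -(fineK (lfin f n)) -(fineK (lfin (f_ k) n)).
rewrite -!EFinB !abse_EFin !lte_fin !ltr_norml -!EFinD !lee_fin.
by move=> /andP[? ?] /andP[? ?] [? ?]; split; lra.
Qed.

End invariant_measures_cvg.
End process_law.

(** * Quantized policies *)

Lemma quantized_approximation_cvg (R : realType) (X A : polishType R)
    (Lambda : nat -> set A) (f : policy X A) (q : nat -> policy X A) :
  quantization_nets Lambda -> quantized_approximation Lambda f q ->
  forall x : X, (q k x : A) @[k --> \oo] --> (f x : A).
Proof.
move=> hL hq x; apply/cvg_ballP => e e0.
have [N _ hN] := near_infty_natSinv_lt (PosNum e0).
exists N.+1 => // -[//|k] /= Nk.
rewrite ballEmdist/=.
have [_ qmin] := hq k.+1 isT x.
have [b Lb fb] := (hL k.+1 isT).2 (f x).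
exact: le_lt_trans (qmin b Lb) (lt_trans fb (hN k Nk)).
Qed.

Theorem mainTheorem2 (R : realType) (X A : polishType R)
  (p : R.-pker (borel X * borel A)%type ~> borel X)
  (c : X * A -> R)
  (P : policy X A -> probability (borel X) R -> probability (traj X A) R)
  (hP : forall f mu, is_process_law p f mu (P f mu))
  (ha : forall (x : X) (a_ : nat -> A) (a : A), a_ n @[n --> \oo] --> a ->
     setwise_cvg (fun n => p (x, a_ n)) (p (x, a)))
  (hb : compact [set: A])
  (hc_ge0 : forall z, (0 <= c z)%R)
  (hc_bounded : exists K, forall z, (c z <= K)%R)
  (hc_measurable : measurable_fun [set: borel X * borel A] c)
  (hc_continuous : forall x : X, continuous (fun a : A => c (x, a)))
  (nu : policy X A -> probability (borel X) R)
  (he : forall f, unique_invariant p f (nu f))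
  (hg : \bigcap_f ergodic_points c P nu f !=set0)
  (hf : setwise_rel_seq_compact (invariant_measures p) \/
     exists x' : borel X, forall B, measurable B ->
       forall e : R, (0 < e)%R -> \forall n \near \oo, forall f,
         `|state_law (P f (\d_x')) n B - nu f B| < e%:E)
  (x : X) (hx : (\bigcap_f ergodic_points c P nu f) x)
  (Lambda : nat -> set A) (hLambda : quantization_nets Lambda)
  (f : policy X A) (q : nat -> policy X A)
  (hq : quantized_approximation Lambda f q) :
  average_cost c (P (q k) (\d_(x : borel X))) @[k --> \oo] -->
  average_cost c (P f (\d_(x : borel X))).
Proof.
have [K cK] := hc_bounded.
have q_cvg := quantized_approximation_cvg hLambda hq.
have costE g : average_cost c (P g \d_(x : borel X)) =
    \int[nu g]_y (policy_cost c g y)%:E.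
  by apply: (average_cost_limit (hP g _) hc_measurable hc_ge0 cK); exact: hx.
rewrite costE; under eq_cvg do rewrite costE.
suff nu_cvg : setwise_cvg (fun k => nu (q k)) (nu f).
  exact: (integral_policy_cost_cvg q_cvg hc_measurable hc_ge0 cK hc_continuous).
have [cpt|[x' unif]] := hf.
  by have := invariant_cvg_of_compact q_cvg ha he cpt.
by have := invariant_cvg_of_uniform q_cvg ha (fun g => hP g \d_x') unif.
Qed.
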